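(* Let $k,\lambda,\varepsilon>0$. For each $n\ge2$ let weights $\alpha_{1,n},\dots,\alpha_{n,n}>0$ with $\sum_{i=1}^n\alpha_{i,n}=1$ be given, and let $\alpha_{\min,n}$, $\alpha_{\max,n}$ be the smallest and largest of them. Let $P_n$ be the probability on $[0,\infty)^n$ with density $\lambda^n e^{-\lambda\|x\|_1}$ (i.e. the $x_i$ are independent exponential with parameter $\lambda$), where $\|x\|_1=\sum_i x_i$. Then there exists $N=N(k,\varepsilon)$ such that for every $n\ge N$, $$P_n\left\{\big[1-(1+\varepsilon)e^{-\gamma}\big]\alpha_{\min,n}\|x\|_1<\sum_{i=1}^n\alpha_{i,n}x_i-\prod_{i=1}^n x_i^{\alpha_{i,n}}<\big[1-(1-\varepsilon)e^{-\gamma}\big]\alpha_{\max,n}\|x\|_1\right\}\ge1-\frac1{n^k}.$$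
   Context: $\gamma$ denotes Euler's constant. *)

(* Defs.v *)
From Stdlib Require Import Reals Lra.
Open Scope R_scope.

Fixpoint sumR (n : nat) (f : nat -> R) : R :=
  match n with O => 0 | S m => sumR m f + f m end.
Fixpoint prodR (n : nat) (f : nat -> R) : R :=
  match n with O => 1 | S m => prodR m f * f m end.

(* minimum / maximum of f 0, ..., f (n-1)  (meaningful for n >= 1) *)
Fixpoint minR (n : nat) (f : nat -> R) : R :=
  match n with O => 0 | 1 => f O | S m => Rmin (minR m f) (f m) end.
Fixpoint maxR (n : nat) (f : nat -> R) : R :=
  match n with O => 0 | 1 => f O | S m => Rmax (maxR m f) (f m) end.

(* real power x^a for x >= 0, with the convention 0^a = 0 (a > 0) *)
Definition rpow (x a : R) : R :=
  if Rlt_dec 0 x then Rpower x a else 0.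

Definition expCDF (lam t : R) : R := 1 - exp (- lam * Rmax 0 t).

(* a box [a_0,b_0] x ... x [a_{n-1},b_{n-1}] in R^n, points are nat -> R
   (only coordinates < n matter) *)
Definition box : Type := ((nat -> R) * (nat -> R))%type.
Definition in_box (n : nat) (B : box) (x : nat -> R) : Prop :=
  forall i, (i < n)%nat -> fst B i <= x i <= snd B i.

Definition box_prob (lam : R) (n : nat) (B : box) : R :=
  prodR n (fun i => Rmax 0 (expCDF lam (snd B i) - expCDF lam (fst B i))).

(* "P_n^*(S) >= c", where P_n^* is the outer measure generated by boxes:
   every countable box cover of S has total P_n-mass >= c.
   (A nonnegative series either converges or diverges to +oo.) *)
Definition prob_ge (lam : R) (n : nat) (S : (nat -> R) -> Prop) (c : R) : Prop :=
  forall C : nat -> box,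
    (forall x, S x -> exists j, in_box n (C j) x) ->
    forall L, Un_cv (fun N => sum_f_R0 (fun j => box_prob lam n (C j)) N) L ->
    c <= L.

Definition euler_seq (m : nat) : R :=
  sum_f_R0 (fun j => / INR (S j)) (Nat.pred m) - ln (INR m).

(* Main.v *)
(* Write A and G for the unweighted arithmetic and geometric means of x. The
   tangent line inequality for exp shows that the gap lies between
   n alpha_min (A - G) and n alpha_max (A - G), so it suffices that G/A is close
   to e^(-gamma). That fails only if, for y = lam x, the mean of y is not close
   to 1 or the mean of ln y is not close to -gamma: four tail events, each of
   which has an indicator dominated by a product [prod_i h(y_i)] with E h < 1.
   For the two logarithmic tails h is built from 1 - e^(-y/m), which is y/m up
   to a factor e^(y/m) and whose real moments are the Beta integrals occurring
   in Euler's product for Gamma; this is how H_m - ln m enters.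
   A box cover of the event and the four Chernoff products form a countable
   family of product functions with sum at least 1 on the open orthant.
   Integrating out one coordinate at a time (monotone convergence on the line)
   gives 1 <= (total mass of the boxes) + 4 r^n with r < 1. *)
Require Import Defs.
From Stdlib Require Import Reals Lra Lia.
From Stdlib Require FunctionalExtensionality.
From mathcomp Require all_boot all_order all_algebra all_classical all_reals all_analysis measurable_realfun Rstruct Rstruct_topology.
From Coquelicot Require Coquelicot.
Open Scope R_scope.

(** * Product covers and integrals against the exponential density *)

Module Integration.
Import all_boot all_order all_algebra all_classical all_reals all_analysis measurable_realfun Rstruct Rstruct_topology.
Import Order.TTheory GRing.Theory Num.Theory numFieldNormedType.Exports.
Local Open Scope classical_set_scope.
Local Open Scope ring_scope.
Local Open Scope ereal_scope.

(** Only integrals over one coordinate occur, so no product measure has to be built. The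
    coefficients [c] are there for the induction on [n]: the integral of the last factor is absorbed
    into them, and the remaining products in [n] coordinates again cover. *)
Lemma product_cover_ge1 d (T : measurableType d) (K : realType)
    (mu : {measure set T -> \bar K}) (D : set T) (w : T -> K) :
    measurable D -> measurable_fun D w -> (forall x, D x -> (0 <= w x)%R) ->
    1 <= \int[mu]_(x in D) (w x)%:E ->
  forall (h : nat -> nat -> T -> K),
    (forall j i, measurable_fun D (h j i)) ->
    (forall j i x, D x -> (0 <= h j i x)%R) ->
  forall n (c : nat -> \bar K), (forall j, 0 <= c j) ->
    (forall x : nat -> T, (forall i, (i < n)%N -> D (x i)) ->
      1 <= \sum_(j <oo) c j * (\prod_(i < n) h j i (x i))%:E) ->
  1 <= \sum_(j <oo) c j * \prod_(i < n) \int[mu]_(x in D) (h j i x * w x)%:E.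
Proof.
move=> mD mw w0 w1 h mh h0; elim=> [|n IH] c c0 cov.
  have := cov (fun=> point) (fun i (Hi : (i < 0)%N) => False_ind _ (notF Hi)).
  by under eq_eseriesr do rewrite big_ord0; under [X in _ -> _ <= X]eq_eseriesr do rewrite big_ord0.
have J0 j i : 0 <= \int[mu]_(x in D) (h j i x * w x)%:E.
  by apply: integral_ge0 => x Dx; rewrite lee_fin mulr_ge0 ?h0 ?w0.
under eq_eseriesr do rewrite big_ord_recr /= [X in _ * X]muleC muleA.
apply: (IH (fun j => c j * \int[mu]_(x in D) (h j n x * w x)%:E)).
  by move=> j; rewrite mule_ge0.
move=> x Dx.
have P0 j : (0 <= \prod_(i < n) h j i (x i))%R.
  by apply: prodr_ge0 => i _; apply/h0/Dx.
have e j : c j * \int[mu]_(x in D) (h j n x * w x)%:E * (\prod_(i < n) h j i (x i))%:E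
   = \int[mu]_(t in D) ((c j * (\prod_(i < n) h j i (x i))%:E) * (h j n t * w t)%:E).
  rewrite ge0_integralZl//.
  - by rewrite muleAC.
  - by apply/measurable_EFinP/measurable_funM.
  - by move=> t Dt; rewrite lee_fin mulr_ge0 ?h0 ?w0.
  - by rewrite mule_ge0 ?lee_fin.
under eq_eseriesr do rewrite e.
(* Monotone convergence exchanges series and integral. It then suffices that the integrand dominates
   [w] pointwise, since the integral of [w] is at least 1. *)
rewrite -integral_nneseries//; last 2 first.
- move=> j; apply: emeasurable_funM => //.
  by apply/measurable_EFinP/measurable_funM.
- by move=> j t Dt; rewrite !mule_ge0// ?lee_fin ?mulr_ge0 ?h0 ?w0.
apply: (le_trans w1); apply: ge0_le_integral => //.
- by apply/measurable_EFinP.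
- apply: ge0_emeasurable_sum => //.
    by move=> j t Dt _; rewrite !mule_ge0// ?lee_fin ?mulr_ge0 ?h0 ?w0.
  move=> j _; apply: emeasurable_funM => //.
  by apply/measurable_EFinP/measurable_funM.
move=> t Dt.
(* The covering hypothesis is applied to [x] extended by the integration variable [t] in coordinate
   [n]. *)
have := cov (fun i => if i == n then t else x i).
have H : forall i, (i < n.+1)%N -> D (if i == n then t else x i).
  by move=> i; case: eqP => // ni; rewrite ltnS leq_eqVlt => /orP[/eqP//|]; exact: Dx.
move=> /(_ H) => le1.
have w0' : 0 <= (w t)%:E by rewrite lee_fin w0.
apply: le_trans (_ : _ <= (w t)%:E * \sum_(j <oo) _) _.
  by rewrite -[leLHS]mule1; apply: lee_wpmul2l le1.
rewrite -nneseriesZl//; last first.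
  move=> j _; rewrite mule_ge0// lee_fin prodr_ge0// => i _; apply: h0; exact: H.
rewrite le_eqVlt; apply/orP; left; apply/eqP; apply: eq_eseriesr => j _.
rewrite big_ord_recr/= eqxx (eq_bigr (fun i : 'I_n => h j i (x i))); last first.
  by move=> i _; rewrite ltn_eqF.
rewrite !EFinM muleC -!muleA; congr (_ * _).
Qed.

(** The hypothesis has the shape of [derivable_pt_lim], so derivatives computed over the Stdlib
    reals can be transported to [is_derive]. *)
Lemma is_derive_eps (K : realType) (f : K -> K) (x l : K) :
  (forall e, (0 < e)%R -> exists2 d, (0 < d)%R & forall h, h != 0%R -> (`|h| < d)%R ->
     (`|(f (x + h) - f x) / h - l| < e)%R) ->
  is_derive x 1%R f l.
Proof.
move=> fl.
have C : h^-1 *: (f (h *: (1%R : K) + x)%R - f x) @[h --> (0%R : K)^'] --> l.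
  apply/cvgrPdist_lt => e e0.
  have [d d0 Hd] := fl e e0.
  exists d => //= h /= hd h0.
  rewrite sub0r normrN in hd.
  have -> : (h^-1 *: (f (h *: (1%R : K) + x) - f x) = (f (x + h) - f x) / h)%R.
    by rewrite [LHS]mulrC (addrC x) [(h *: _)%R]mulr1.
  by rewrite distrC; exact: Hd.
by split; [apply/cvg_ex; exists l | exact/cvg_lim].
Qed.

Lemma integral_segment (K : realType) (f F : K -> K) (a b : K) : (a < b)%R ->
  (forall x : K, (a <= x)%R -> is_derive x 1%R F (f x)) ->
  (forall x : K, (a <= x)%R -> {for x, continuous f}) ->
  \int[@lebesgue_measure K]_(x in `[a, b]) (f x)%:E = (F b - F a)%:E.
Proof.
move=> ab dF cf; rewrite EFinB; apply: continuous_FTC2 => //.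
- apply: continuous_in_subspaceT => x; rewrite inE/= in_itv/= => /andP[ax _].
  exact/cf.
- have cF x : (a <= x)%R -> {for x, continuous F}.
    move=> ax; apply: differentiable_continuous; apply/derivable1_diffP.
    by have [] := dF x ax.
  split.
  + move=> x; rewrite in_itv/= => /andP[/ltW ax _].
    by have [] := dF x ax.
  + exact/cvg_at_right_filter/cF.
  + exact/cvg_at_left_filter/cF/ltW.
- move=> x; rewrite in_itv/= => /andP[/ltW ax _].
  by rewrite derive1E; have [] := dF x ax.
Qed.

(** The open ray is exhausted by compact intervals, on each of which the fundamental theorem gives a
    difference of two values in [0, r]. Nothing is assumed at 0, where the integrand may blow up,
    and no limit of [F] is needed. *)
Lemma integral_ray_le (K : realType) (f F : K -> K) (r : K) :
  (forall x : K, (0 < x)%R -> (0 <= f x)%R) ->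
  (forall x : K, (0 < x)%R -> is_derive x 1%R F (f x)) ->
  (forall x : K, (0 < x)%R -> {for x, continuous f}) ->
  (forall x : K, (0 < x)%R -> (0 <= F x <= r)%R) ->
  \int[@lebesgue_measure K]_(x in `]0%R, +oo[) (f x)%:E <= r%:E.
Proof.
move=> f0 dF cf Fr.
(* Starting at 2 makes every interval nondegenerate: 1/(n+2) < 1 < n+2. *)
pose A (n : nat) : set K := `[(n.+2%:R^-1)%R, n.+2%:R]%classic.
have A0 n x : A n x -> (0 < x)%R.
  by rewrite /A/= in_itv/= => /andP[+ _]; apply: lt_le_trans; rewrite invr_gt0.
have -> : `]0%R, +oo[%classic = \bigcup_n A n.
  apply/seteqP; split => [x|x [n _ /A0 x0]]; last by rewrite /= in_itv/= x0.
  rewrite /= in_itv/= andbT => x0.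
  have [n Hn] : exists n : nat, (x + x^-1 < n%:R)%R.
    exists (Num.truncn (x + x^-1)).+1; exact: Num.Theory.truncnS_gt.
  exists n => //; rewrite /A/= in_itv/=.
  have x1 : (0 < x^-1)%R by rewrite invr_gt0.
  have n2 : (n%:R <= n.+2%:R :> K)%R by rewrite ler_nat -addn2 leq_addr.
  apply/andP; split; last first.
    by apply/ltW/(lt_le_trans _ n2)/(le_lt_trans _ Hn); rewrite lerDl ltW.
  rewrite -[leRHS]invrK lef_pV2 ?posrE//.
  by apply/ltW/(lt_le_trans _ n2)/(le_lt_trans _ Hn); rewrite lerDr ltW.
have mf n : measurable_fun (A n) (fun x => (f x)%:E).
  apply/measurable_EFinP; apply: subspace_continuous_measurable_fun; first exact: measurable_itv.
  apply: continuous_in_subspaceT => x; rewrite inE => /A0 x0.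
  exact/cf.
have C : \int[@lebesgue_measure K]_(x in A n) (f x)%:E @[n --> \oo] -->
    \int[@lebesgue_measure K]_(x in \bigcup_n A n) (f x)%:E.
  apply: ge0_nondecreasing_set_cvg_integral => //.
  - apply/nondecreasing_seqP => n; rewrite subsetEset /A => x /=.
    rewrite !in_itv/= => /andP[h1 h2]; apply/andP; split.
      by apply: le_trans h1; rewrite lef_pV2 ?posrE// ler_nat.
    by rewrite (le_trans h2)// ler_nat.
  - by move=> n; exact: measurable_itv.
  - by move=> n x /A0 x0; rewrite lee_fin f0.
rewrite -(cvg_lim _ C)//; apply: lime_le; first by apply/cvg_ex; eexists; exact: C.
apply: nearW => n.
have n0 : (0 < n.+2%:R^-1 :> K)%R by rewrite invr_gt0.
have n1 : (0 < n.+2%:R :> K)%R by [].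
have -> : \int[@lebesgue_measure K]_(x in A n) (f x)%:E = (F n.+2%:R - F n.+2%:R^-1)%:E.
  apply: integral_segment.
  - by rewrite (@lt_trans _ _ 1%R) ?invf_lt1 ?ltr1n.
  - by move=> x nx; apply/dF/(lt_le_trans n0).
  - by move=> x nx; apply/cf/(lt_le_trans n0).
rewrite lee_fin; have /andP[F1 _] := Fr _ n0; have /andP[_ F2] := Fr _ n1.
by rewrite lerBlDr (le_trans F2)// lerDl.
Qed.

Lemma exponential_density_integral (K : realType) (lam : K) : (0 < lam)%R ->
  \int[@lebesgue_measure K]_(x in `]0%R, +oo[) (lam * expR (- (lam * x)))%:E = 1.
Proof.
move=> l0; rewrite integral_itv_obnd_cbnd; last first.
  apply/measurable_EFinP/measurable_funM => //.
  apply: measurableT_comp => //; apply: measurableT_comp => //.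
rewrite -(integral_exponential_pdf l0) integral_mkcond/=; apply: eq_integral => x _.
rewrite /exponential_pdf !patchE; case: ifPn => // _.
by rewrite mulNr.
Qed.

(** An upper bound on the mean is all that the covering argument uses. The open ray leaves out 0,
    where the logarithmic factors are singular. *)
Definition exp_mean_le (K : realType) (lam : K) (h : K -> K) (r : K) : Prop :=
  [/\ measurable_fun (`]0%R, +oo[%classic : set K) h, forall x, (0 < x)%R -> (0 <= h x)%R
    & \int[@lebesgue_measure K]_(x in `]0%R, +oo[)
        (h x * (lam * expR (- (lam * x))))%:E <= r%:E].

Lemma is_derive_expRN (K : realType) (lam x : K) :
  is_derive x 1%R (fun x => - expR (- (lam * x)))%R (lam * expR (- (lam * x)))%R.
Proof.
have H1 : is_derive x 1%R ((- lam) \*: (@id K))%R (- lam)%R.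
  by apply: is_derive_eq; rewrite scaler1.
have H2 := @is_derive1_comp K expR ((- lam) \*: (@id K))%R x _ _ (is_derive_expR _) H1.
have -> : (fun x : K => - expR (- (lam * x)))%R = (- (expR \o ((- lam) \*: (@id K))))%R.
  by apply/funext => t; congr (- expR _)%R; exact/esym/mulNr.
apply: is_derive_eq.
rewrite mulrN opprK mulrC; congr (_ * expR _)%R; exact: mulNr.
Qed.

Lemma continuous_exponential_density (K : realType) (lam : K) :
  continuous (fun x => lam * expR (- (lam * x)))%R.
Proof.
move=> x; apply: differentiable_continuous; apply/derivable1_diffP.
by apply: derivableM => //; exact: ex_derive.
Qed.

Lemma exp_mean_le_antiderivative (K : realType) (lam : K) (h F : K -> K) (r : K) :
  (0 < lam)%R ->
  (forall x, (0 < x)%R -> (0 <= h x)%R) ->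
  (forall x, (0 < x)%R -> {for x, continuous h}) ->
  (forall x : K, (0 < x)%R -> is_derive x 1%R F (h x * (lam * expR (- (lam * x))))%R) ->
  (forall x, (0 < x)%R -> (0 <= F x <= r)%R) ->
  exp_mean_le K lam h r.
Proof.
move=> l0 h0 ch dF Fr; split => //.
  apply: open_continuous_measurable_fun => // x.
  by rewrite inE/= in_itv/= andbT; exact: ch.
apply: (@integral_ray_le K _ F) => //.
- by move=> x x0; rewrite mulr_ge0 ?h0// mulr_ge0 ?expR_ge0// ltW.
- move=> x x0; apply: continuousM; first exact: ch.
  exact: continuous_exponential_density.
Qed.

Lemma exp_mean_le_interval (K : realType) (lam a b : K) : (0 < lam)%R ->
  exp_mean_le K lam (fun x => ((a <= x <= b)%R : nat)%:R%R)
    (Num.max 0 (expR (- (lam * Num.max 0 a)) - expR (- (lam * Num.max 0 b))))%R.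
Proof.
move=> l0.
have -> : (fun x => ((a <= x <= b)%R : nat)%:R%R) = \1_`[a, b] :> (K -> K).
  by apply/funext => x; rewrite indicE mem_setE in_itv.
have e0 x : (0 <= lam * expR (- (lam * x)))%R by rewrite mulr_ge0 ?expR_ge0// ltW.
split => //.
under eq_integral do rewrite EFinM muleC.
rewrite -(epatch_indic (fun x => (lam * expR (- (lam * x)))%:E)) -integral_mkcondr.
set c := Num.max 0%R a.
have mE : measurable_fun [set: K] (fun x : K => (lam * expR (- (lam * x)))%:E).
  apply/measurable_EFinP; apply: continuous_measurable_fun.
  exact: continuous_exponential_density.
(* The part of [a, b] inside the open ray lies in [c, b] with c = max(0, a). If b <= c this is at
   most a point, which the outer maximum with 0 accounts for. *)
apply: (@le_trans _ _ (\int[@lebesgue_measure K]_(x in `[c, b]) (lam * expR (- (lam * x)))%:E)).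
  apply: ge0_subset_integral => //.
  - exact: measurableI.
  - exact: measurable_funTS.
  - by move=> x _; rewrite lee_fin.
  - move=> x /= []; rewrite !in_itv/= andbT => x0 /andP[ax xb].
    by rewrite xb ge_max ax ltW.
have [cb|bc] := ltP c b; last first.
  move: bc; rewrite le_eqVlt => /orP[/eqP <-|bc].
    by rewrite set_itv1 integral_set1 lee_fin le_max lexx.
  by rewrite set_itv_ge ?integral_set0 ?lee_fin ?le_max ?lexx// bnd_simp -ltNge.
have -> : \int[@lebesgue_measure K]_(x in `[c, b]) (lam * expR (- (lam * x)))%:E =
    (- expR (- (lam * b)) - - expR (- (lam * c)))%:E.
  apply: (@integral_segment K _ (fun x => - expR (- (lam * x)))%R) => //.
    by move=> x _; exact: is_derive_expRN.
  by move=> x _; exact: continuous_exponential_density.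
rewrite lee_fin le_max; apply/orP; right.
have -> : Num.max 0%R b = b.
  by apply/max_idPr; apply: le_trans (ltW cb); rewrite le_max lexx.
by rewrite opprK addrC.
Qed.

(** One product with value at least 1 already makes the nonnegative series at least 1, so
    [product_cover_ge1] applies with all coefficients 1. The cover is required on the open orthant
    only. *)
Lemma exponential_product_cover (K : realType) (lam : K) (n : nat)
    (h : nat -> nat -> K -> K) (r : nat -> nat -> K) (M : K) :
  (0 < lam)%R -> (forall j i, exp_mean_le K lam (h j i) (r j i)) ->
  (forall x : nat -> K, (forall i, (i < n)%N -> (0 < x i)%R) ->
    exists j, (1 <= \prod_(i < n) h j i (x i))%R) ->
  (forall N, (\sum_(j < N) \prod_(i < n) r j i <= M)%R) ->
  (1 <= M)%R.
Proof.
move=> l0 hr cov rM.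
pose w (x : K) := (lam * expR (- (lam * x)))%R.
pose J j i := \int[@lebesgue_measure K]_(x in `]0%R, +oo[) (h j i x * w x)%:E.
have w0 x : (0 <= w x)%R by rewrite mulr_ge0 ?expR_ge0// ltW.
have h0 j i x : (`]0%R, +oo[%classic : set K) x -> (0 <= h j i x)%R.
  by rewrite /= in_itv/= andbT => x0; have [_ + _] := hr j i; apply.
have J0 j i : 0 <= J j i.
  by apply: integral_ge0 => x x0; rewrite lee_fin mulr_ge0// h0.
have le1 : 1 <= \sum_(j <oo) 1 * \prod_(i < n) J j i.
  apply: product_cover_ge1 => //.
  - apply: measurable_funTS; apply: continuous_measurable_fun.
    exact: continuous_exponential_density.
  - by rewrite exponential_density_integral.
  - by move=> j i; have [] := hr j i.
  - move=> x x0; have [|j jx] := cov x.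
      by move=> i /x0; rewrite /= in_itv/= andbT.
    have p0 k : 0 <= 1 * (\prod_(i < n) h k i (x i))%:E.
      by rewrite mul1e lee_fin prodr_ge0// => i _; exact/h0/x0.
    apply: le_trans (nneseries_lim_ge j.+1 (fun k _ _ => p0 k)).
    rewrite big_nat_recr//= -[leLHS]add0e; apply: leeD.
      by apply: sume_ge0.
    by rewrite mul1e lee_fin.
rewrite -lee_fin; apply: (le_trans le1).
apply: lime_le.
  by apply: is_cvg_nneseries => j _ _; rewrite mul1e prode_ge0.
apply: nearW => N.
apply: le_trans (_ : _ <= (\sum_(j < N) \prod_(i < n) r j i)%:E) _; last first.
  by rewrite lee_fin.
rewrite big_mkord -sumEFin; apply: lee_sum => j _.
rewrite mul1e; elim: {cov rM le1} n => [|n IH]; first by rewrite !big_ord0.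
rewrite !big_ord_recr/= EFinM; apply: lee_pmul => //; first exact: prode_ge0.
by have [_ _] := hr j n.
Qed.

Lemma is_derive_of_derivable_pt_lim (f : R -> R) (x l : R) :
  derivable_pt_lim f x l -> @is_derive R R^o R^o x 1%R f l.
Proof.
move=> fl; apply: (@is_derive_eps R) => e /RltP e0.
have [[d d0] Hd] := fl e e0.
exists d; first exact/RltP.
move=> h /eqP h0 /RltP hd.
by have /RltP := Hd h h0 ltac:(by rewrite RabsE); rewrite RabsE RdivE.
Qed.

Definition exp_mean_leR : R -> (R -> R) -> R -> Prop := exp_mean_le R.

Lemma exp_mean_leR_antiderivative (lam : R) (h F : R -> R) (r : R) :
  Rlt 0 lam ->
  (forall x, Rlt 0 x -> Rle 0 (h x)) ->
  (forall x, Rlt 0 x -> continuity_pt h x) ->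
  (forall x, Rlt 0 x ->
    derivable_pt_lim F x (Rmult (h x) (Rmult lam (Rtrigo_def.exp (Ropp (Rmult lam x)))))) ->
  (forall x, Rlt 0 x -> Rle 0 (F x) /\ Rle (F x) r) ->
  exp_mean_leR lam h r.
Proof.
move=> /RltP l0 h0 ch dF Fr; apply: (@exp_mean_le_antiderivative R lam h F r) => //.
- by move=> x /RltP x0; apply/RleP/h0.
- by move=> x /RltP x0; apply/continuity_pt_cvg/ch.
- by move=> x /RltP x0; rewrite -RexpE; apply/is_derive_of_derivable_pt_lim/dF.
- by move=> x /RltP x0; apply/andP; have [/RleP ? /RleP ?] := Fr x x0.
Qed.

Lemma exp_mean_leR_interval (lam a b : R) (h : R -> R) : Rlt 0 lam ->
  (forall x, Rle a x /\ Rle x b -> h x = R1) ->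
  (forall x, ~ (Rle a x /\ Rle x b) -> h x = R0) ->
  exp_mean_leR lam h (Rmax 0 (Rminus (expCDF lam b) (expCDF lam a))).
Proof.
move=> /RltP l0 h1 h0.
have -> : h = (fun x => ((a <= x <= b)%R : nat)%:R%R).
  apply/funext => x; case: (boolP (_ <= _ <= _)%R) => [/andP[/RleP ax /RleP xb]|/negP nab].
    by rewrite h1.
  by rewrite h0// => -[/RleP ax /RleP xb]; apply: nab; rewrite ax.
have -> : Rmax 0 (Rminus (expCDF lam b) (expCDF lam a)) =
   (Num.max 0 (expR (- (lam * Num.max 0 a)) - expR (- (lam * Num.max 0 b))))%R.
  rewrite -!RmaxE -!RexpE /expCDF -!RmultE -!RoppE -RplusE !Ropp_mult_distr_l.
  congr (Rmax _ _).
  rewrite -[X in _ = Rplus (Rtrigo_def.exp (Rmult _ (Rmax X _))) (Ropp (Rtrigo_def.exp (Rmult _ (Rmax X _))))]R0E.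
  by rewrite /Rminus; lra.
exact: exp_mean_le_interval.
Qed.

Lemma exponential_product_coverR (lam : R) (n : nat)
    (h : nat -> nat -> R -> R) (r : nat -> nat -> R) (M : R) :
  Rlt 0 lam -> (forall j i, exp_mean_leR lam (h j i) (r j i)) ->
  (forall x : nat -> R, (forall i, Nat.lt i n -> Rlt 0 (x i)) ->
    exists j, Rle 1 (prodR n (fun i => h j i (x i)))) ->
  (forall N, Rle (sumR N (fun j => prodR n (r j))) M) ->
  Rle 1 M.
Proof.
move=> /RltP l0 hr cov rM.
have prodRE f : prodR n f = (\prod_(i < n) f i)%R.
  elim: n {cov rM} => [|n IH] /=; first by rewrite big_ord0.
  by rewrite big_ord_recr/= IH.
have sumRE N f : sumR N f = (\sum_(i < N) f i)%R.
  elim: N => [|N IH] /=; first by rewrite big_ord0.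
  by rewrite big_ord_recr/= IH.
apply/RleP; apply: (@exponential_product_cover R lam n h r M) => //.
  move=> x x0; have [|j] := cov x; first by move=> i /ssrnat.ltP /x0 /RltP.
  by rewrite prodRE => /RleP jx; exists j.
move=> N; have /RleP := rM N; rewrite sumRE.
by under eq_bigr do rewrite prodRE.
Qed.
End Integration.

(** * Incomplete Beta integrals and Euler's product *)

Import Integration.

(* [beta s p] is the integral of (1-v)^s v^p over [0,1], and [beta_tail s p v]
   its part over [v,1]; the recursions are integration by parts. *)
Fixpoint beta (s : R) (p : nat) : R :=
  match p with
  | O => / (s + 1)
  | S q => INR (S q) * beta s q / (s + 1 + INR (S q))
  end.

Fixpoint beta_tail (s : R) (p : nat) (v : R) : R :=
  match p with
  | O => exp ((s + 1) * ln (1 - v)) / (s + 1)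
  | S q => (INR (S q) * beta_tail s q v + exp ((s + 1) * ln (1 - v)) * v ^ S q)
           / (s + 1 + INR (S q))
  end.

Module Derivatives.
Import Coquelicot.Coquelicot.

(** Here [exp (s * ln (1 - v))] is the real power (1-v)^s. In the induction, the derivative of the
    boundary term (1-v)^(s+1) v^(q+1) combines with that of the previous tail into -(s+q+2) (1-v)^s
    v^(q+1), and the denominator cancels the constant. *)
Lemma derivable_beta_tail s p v : -1 < s -> v < 1 ->
  derivable_pt_lim (beta_tail s p) v (- (exp (s * ln (1 - v)) * v ^ p)).
Proof.
intros Hs Hv. apply is_derive_Reals.
assert (E : exp ((s + 1) * ln (1 - v)) = exp (s * ln (1 - v)) * (1 - v)).
{ rewrite Rmult_plus_distr_r, exp_plus, Rmult_1_l, exp_ln by lra. reflexivity. }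
induction p as [|q IH].
- simpl. auto_derive; [lra|].
  change (1 + - v) with (1 - v). rewrite E. field. lra.
- assert (Hq := pos_INR (S q)).
  assert (D : is_derive (fun v => exp ((s + 1) * ln (1 - v)) * v ^ S q) v
    (INR (S q) * exp (s * ln (1 - v)) * (1 - v) * v ^ q
     - (s + 1) * exp (s * ln (1 - v)) * v ^ S q)).
  { auto_derive; [lra|]. change (1 + - v) with (1 - v). rewrite E. change (Nat.pred (S q)) with q.
    change (v ^ S q) with (v * v ^ q). change (match q with O => 1 | S _ => INR q + 1 end) with (INR (S q)).
    field. lra. }
  apply is_derive_ext with (f := fun v => / (s + 1 + INR (S q)) *
    (INR (S q) * beta_tail s q v + exp ((s + 1) * ln (1 - v)) * v ^ S q)).
  { intros t. cbn [beta_tail]. unfold Rdiv. apply Rmult_comm. }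
  evar_last.
  { apply is_derive_scal, (@is_derive_plus R_AbsRing R_NormedModule); [apply is_derive_scal, IH | exact D]. }
  change plus with Rplus. change (v ^ S q) with (v * v ^ q). field. lra.
Qed.

Lemma derivable_beta_tail_exp c s p k x : -1 < s -> 0 < k -> 0 < x ->
  derivable_pt_lim (fun x => c * beta_tail s p (exp (- (k * x)))) x
    (c * k * (exp (s * ln (1 - exp (- (k * x)))) * exp (- (INR p + 1) * (k * x)))).
Proof.
intros Hs Hk Hx. apply is_derive_Reals.
assert (Hv : exp (- (k * x)) < 1) by (rewrite <- exp_0; apply exp_increasing; nra).
evar_last.
{ apply is_derive_scal, (is_derive_comp (beta_tail s p)).
  - apply is_derive_Reals, derivable_beta_tail; assumption.
  - auto_derive; [exact I | reflexivity]. }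
unfold scal; simpl; unfold mult; simpl.
(* The extra factor e^(-kx) comes from the chain rule and raises the exponent p to p+1. *)
assert (E : exp (- (INR p + 1) * (k * x)) = exp (- (k * x)) * exp (- (k * x)) ^ p).
{ clear. induction p as [|p IH]; [simpl; rewrite Rmult_1_r; f_equal; ring|].
  rewrite S_INR. simpl pow. rewrite <- IH, <- exp_plus. f_equal. ring. }
rewrite E. ring.
Qed.

Lemma continuity_pt_exp_tilt c s q k x : 0 < k -> 0 < x ->
  continuity_pt (fun x => exp (c + s * ln (1 - exp (- (k * x))) - q * (k * x))) x.
Proof.
intros Hk Hx.
assert (Hv : exp (- (k * x)) < 1) by (rewrite <- exp_0; apply exp_increasing; nra).
apply derivable_continuous_pt, ex_derive_Reals_0.
auto_derive. lra.
Qed.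
End Derivatives.

Lemma beta_tail_0 s p : beta_tail s p 0 = beta s p.
Proof.
induction p as [|p IH]; cbn [beta_tail beta]; rewrite Rminus_0_r, ln_1, Rmult_0_r, exp_0.
- unfold Rdiv. ring.
- rewrite IH, pow_i by apply Nat.lt_0_succ. unfold Rdiv. ring.
Qed.

Lemma beta_tail_nonneg s p v : -1 < s -> 0 <= v -> 0 <= beta_tail s p v.
Proof.
intros Hs Hv. induction p as [|p IH]; cbn [beta_tail].
- apply Rle_mult_inv_pos; [left; apply exp_pos | lra].
- assert (Hp := pos_INR (S p)). apply Rle_mult_inv_pos; [|lra].
  apply Rplus_le_le_0_compat; apply Rmult_le_pos; try assumption.
  + left; apply exp_pos.
  + apply pow_le; assumption.
Qed.

Lemma beta_tail_le s p v : -1 < s -> 0 < v < 1 -> beta_tail s p v <= beta s p.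
Proof.
intros Hs Hv. rewrite <- beta_tail_0.
destruct (MVT_cor2 (beta_tail s p) (fun v => - (exp (s * ln (1 - v)) * v ^ p)) 0 v)
  as [c [Hc Hc']]; [lra | |].
- intros c Hc. apply Derivatives.derivable_beta_tail; lra.
- assert (0 <= exp (s * ln (1 - c)) * v) by (apply Rmult_le_pos; [left; apply exp_pos | lra]).
  assert (0 <= c ^ p) by (apply pow_le; lra).
  assert (0 <= exp (s * ln (1 - c)) * c ^ p * (v - 0)) by nra.
  nra.
Qed.

(* The substitution v = e^(-lam x/m) turns the mean into a Beta integral. *)
Lemma exp_tilt_mean lam m lc s p : 0 < lam -> 0 < m -> -1 < s ->
  exp_mean_leR lam
    (fun x => exp (lc + s * ln (1 - exp (- (lam / m * x))) - (INR p + 1 - m) * (lam / m * x)))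
    (exp lc * m * beta s p).
Proof.
intros Hl Hm Hs.
assert (Hk : 0 < lam / m) by (apply Rdiv_lt_0_compat; assumption).
assert (Hc : 0 < exp lc * m) by (apply Rmult_lt_0_compat; [apply exp_pos | assumption]).
apply exp_mean_leR_antiderivative with
  (F := fun x => exp lc * m * beta_tail s p (exp (- (lam / m * x)))).
- assumption.
- intros x _. left; apply exp_pos.
- intros x Hx. apply Derivatives.continuity_pt_exp_tilt; assumption.
- intros x Hx.
  (* With v = e^(-lam x/m) the density contributes v^m, so the factor v^(p+1-m) in the integrand
     leaves v^(p+1), as the chain rule requires. *)
  replace (exp (lc + s * ln (1 - exp (- (lam / m * x))) - (INR p + 1 - m) * (lam / m * x))
      * (lam * exp (- (lam * x)))) with
    (exp lc * m * (lam / m) * (exp (s * ln (1 - exp (- (lam / m * x)))) *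
       exp (- (INR p + 1) * (lam / m * x)))).
  { apply Derivatives.derivable_beta_tail_exp; assumption. }
  replace (exp lc * m * (lam / m)) with (lam * exp lc) by (field; lra).
  assert (E : forall a b c d e, a + b + c = d + e ->
    lam * exp a * (exp b * exp c) = exp d * (lam * exp e)).
  { intros a b c d e H. transitivity (lam * exp (d + e)).
    - rewrite <- H, !exp_plus. ring.
    - rewrite exp_plus. ring. }
  apply E. field. lra.
- intros x Hx.
  assert (Hv : 0 < exp (- (lam / m * x)) < 1).
  { split; [apply exp_pos|]. rewrite <- exp_0. apply exp_increasing. nra. }
  split.
  + apply Rmult_le_pos; [lra | apply beta_tail_nonneg; lra].
  + apply Rmult_le_compat_l; [lra | apply beta_tail_le; lra].
Qed.

(** Since 1/(1+u) = 1 - u/(1+u), it is at most exp(-u/(1+u)), where -u/(1+u) = -u + u^2/(1+u) and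
    1/(1+u) <= 2. *)
Lemma inv_1_plus_le_exp u : -1/2 <= u -> / (1 + u) <= exp (- u + 2 * u ^ 2).
Proof.
intros Hu.
apply Rle_trans with (1 + - u / (1 + u)).
- right. field. lra.
- eapply Rle_trans; [apply exp_ineq1_le|].
  destruct (Req_dec (- u / (1 + u)) (- u + 2 * u ^ 2)) as [->|N]; [lra|].
  left. apply exp_increasing.
  enough (- u / (1 + u) <= - u + 2 * u ^ 2) by lra.
  replace (- u / (1 + u)) with (- u + u ^ 2 * / (1 + u)) by (field; lra).
  assert (/ (1 + u) <= 2).
  { replace 2 with (/ (1/2)) by field. apply Rinv_le_contravar; lra. }
  nra.
Qed.

(** The index is shifted: this is H_(p+1), the sum inside [euler_seq (S p)]. *)
Definition harmonic (p : nat) : R := sum_f_R0 (fun j => / INR (S j)) p.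

(* This is Euler's product [prod_(j <= p+1) 1/(1+s/j)], whose logarithm is
   [- s H_(p+1)] up to [s^2 sum 1/j^2]. *)
Lemma beta_le s p : -1/2 <= s ->
  (INR p + 1) * beta s p <= exp (- s * harmonic p + 4 * s ^ 2).
Proof.
intros Hs.
(* Strengthened for induction: 2 - 1/(p+1) bounds the sum of 1/j^2 over j <= p+1, and its increment
   1/(p+1) - 1/(p+2) exceeds 1/(p+2)^2. *)
apply Rle_trans with (exp (- s * harmonic p + 2 * s ^ 2 * (2 - / (INR p + 1)))).
- induction p as [|p IH].
  + cbn [beta]. replace (harmonic 0) with 1 by (unfold harmonic; simpl; field).
    simpl INR. rewrite Rplus_0_l, Rmult_1_l, Rplus_comm.
    eapply Rle_trans; [apply inv_1_plus_le_exp; lra|]. right. f_equal. field.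
  + assert (Hp := pos_INR p).
    assert (U : -1/2 <= s / (INR p + 2)).
    { apply Rmult_le_reg_r with (INR p + 2); [lra|].
      replace (s / (INR p + 2) * (INR p + 2)) with s by (field; lra). nra. }
    apply Rle_trans with ((INR p + 1) * beta s p * / (1 + s / (INR p + 2))).
    { right. cbn [beta]. rewrite S_INR. field. lra. }
    eapply Rle_trans.
    { apply Rmult_le_compat.
      - apply Rmult_le_pos; [lra|]. rewrite <- beta_tail_0. apply beta_tail_nonneg; lra.
      - left. apply Rinv_0_lt_compat. lra.
      - exact IH.
      - apply inv_1_plus_le_exp, U. }
    rewrite <- exp_plus.
    assert (E : harmonic (S p) = harmonic p + / (INR p + 2)).
    { unfold harmonic. rewrite tech5, !S_INR. do 2 f_equal. lra. }
    rewrite E, S_INR.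
    assert (I : (/ (INR p + 2)) ^ 2 <= / (INR p + 1) - / (INR p + 2)).
    { replace (/ (INR p + 1) - / (INR p + 2)) with (/ (INR p + 1) * / (INR p + 2)) by (field; lra).
      simpl. rewrite Rmult_1_r. apply Rmult_le_compat_r; [left; apply Rinv_0_lt_compat; lra|].
      apply Rinv_le_contravar; lra. }
    assert (Hs2 : 0 <= s ^ 2) by apply pow2_ge_0.
    replace (INR p + 1 + 1) with (INR p + 2) by ring.
    match goal with |- exp ?a <= exp ?b => assert (L : a <= b) end.
    { unfold Rdiv. rewrite Rpow_mult_distr. nra. }
    destruct L as [L| ->]; [left; apply exp_increasing, L | right; reflexivity].
- assert (Hp := pos_INR p).
  assert (0 < / (INR p + 1)) by (apply Rinv_0_lt_compat; lra).
  assert (Hs2 : 0 <= s ^ 2) by apply pow2_ge_0.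
  match goal with |- exp ?a <= exp ?b => assert (L : a <= b) by nra end.
  destruct L as [L| ->]; [left; apply exp_increasing, L | right; reflexivity].
Qed.

(** * Monotonicity, finite sums and finite products *)

Lemma exp_le a b : a <= b -> exp a <= exp b.
Proof.
intros [H| ->]; [left; apply exp_increasing, H | right; reflexivity].
Qed.

Lemma ln_le a b : 0 < a -> a <= b -> ln a <= ln b.
Proof.
intros Ha [H| ->]; [left; apply ln_increasing; assumption | right; reflexivity].
Qed.

Lemma sumR_scal n c f : sumR n (fun i => c * f i) = c * sumR n f.
Proof. induction n as [|n IH]; simpl; [|rewrite IH]; ring. Qed.

Lemma sumR_plus n f g : sumR n (fun i => f i + g i) = sumR n f + sumR n g.
Proof. induction n as [|n IH]; simpl; [|rewrite IH]; ring. Qed.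

Lemma sumR_const n c : sumR n (fun _ => c) = INR n * c.
Proof. induction n as [|n IH]; [simpl; ring|]. rewrite S_INR. simpl. rewrite IH. ring. Qed.

Lemma sumR_le n f g : (forall i, (i < n)%nat -> f i <= g i) -> sumR n f <= sumR n g.
Proof.
induction n as [|n IH]; intros H; simpl; [lra|].
apply Rplus_le_compat; [apply IH; intros i Hi; apply H; lia | apply H; lia].
Qed.

Lemma sumR_ext n f g : (forall i, (i < n)%nat -> f i = g i) -> sumR n f = sumR n g.
Proof. intros H. apply Rle_antisym; apply sumR_le; intros i Hi; rewrite H by exact Hi; lra. Qed.

Lemma prodR_ext n f g : (forall i, (i < n)%nat -> f i = g i) -> prodR n f = prodR n g.
Proof.
induction n as [|n IH]; intros H; simpl; [reflexivity|].
rewrite IH, H; [reflexivity | lia | intros i Hi; apply H; lia].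
Qed.

Lemma prodR_exp n f : prodR n (fun i => exp (f i)) = exp (sumR n f).
Proof. induction n as [|n IH]; simpl; [rewrite exp_0 | rewrite IH, exp_plus]; reflexivity. Qed.

Lemma prodR_const n c : prodR n (fun _ => c) = c ^ n.
Proof. induction n as [|n IH]; simpl; [|rewrite IH]; ring. Qed.

(** * Chernoff bounds for the four tail events *)

(* Under i.i.d. unit exponential coordinates the event [sum g(y_i) >= 0] has
   probability at most [r^n]: [prod h(y_i)] dominates its indicator. *)
Definition chernoff (g : R -> R) : Prop :=
  exists (h : R -> R) (r : R), 0 < r < 1 /\
    (forall lam, 0 < lam -> exp_mean_leR lam (fun x => h (lam * x)) r) /\
    (forall n y, (forall i, (i < n)%nat -> 0 < y i) ->
       0 <= sumR n (fun i => g (y i)) -> 1 <= prodR n (fun i => h (y i))).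

(** Exponential Markov inequality with parameter [t]: the right-hand side of the pointwise bound is
    ln h, so a nonnegative sum of g makes the product of h at least e^0. The mean of h is the Beta
    expression assumed below 1. *)
Lemma chernoff_intro g m t lc s p : 0 < m -> 0 < t -> -1 < s ->
  (forall y, 0 < y ->
    t * g y <= lc + s * ln (1 - exp (- (y / m))) - (INR p + 1 - m) * (y / m)) ->
  exp lc * m * beta s p < 1 ->
  chernoff g.
Proof.
intros Hm Ht Hs Hg H1.
exists (fun y => exp (lc + s * ln (1 - exp (- (y / m))) - (INR p + 1 - m) * (y / m))),
  (exp lc * m * beta s p).
split; [split; [|exact H1]|split].
- apply Rmult_lt_0_compat.
  + apply Rmult_lt_0_compat; [apply exp_pos | exact Hm].
  + clear - Hs. induction p as [|p IH]; cbn [beta].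
    * apply Rinv_0_lt_compat. lra.
    * assert (H := pos_INR p). apply Rdiv_lt_0_compat; rewrite S_INR; [apply Rmult_lt_0_compat|]; lra.
- intros lam Hl.
  replace (fun x => _) with
    (fun x => exp (lc + s * ln (1 - exp (- (lam / m * x))) - (INR p + 1 - m) * (lam / m * x))).
  + apply exp_tilt_mean; assumption.
  + apply FunctionalExtensionality.functional_extensionality. intros x.
    replace (lam * x / m) with (lam / m * x) by (field; lra). reflexivity.
- intros n y Hy Hge. rewrite prodR_exp. apply Rle_trans with (exp 0); [rewrite exp_0; lra|]. apply exp_le.
  apply Rle_trans with (sumR n (fun i => t * g (y i)));
    [|apply sumR_le; intros i Hi; apply Hg, Hy, Hi].
  rewrite sumR_scal. apply Rmult_le_pos; lra.
Qed.

Lemma beta_0 p : beta 0 p = / (INR p + 1).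
Proof.
induction p as [|p IH]; cbn [beta]; [simpl; f_equal; ring|].
rewrite IH. assert (H := pos_INR p). rewrite S_INR. field. lra.
Qed.

Lemma exists_large_inv e : 0 < e -> exists M, forall p, (M <= p)%nat -> / (INR p + 1) < e.
Proof.
intros He. destruct (archimed_cor1 e He) as [M [HM HM']]. exists M. intros p Hp.
apply Rlt_trans with (/ INR M); [|exact HM].
assert (0 < INR M) by (apply lt_0_INR; exact HM').
assert (INR M <= INR p) by (apply le_INR; exact Hp).
apply Rinv_lt_contravar; [apply Rmult_lt_0_compat|]; lra.
Qed.

(** With s = 0 this is the classical tilt e^(t(y-1-d)) at t = 1/(p+2), where E e^(ty) = (p+2)/(p+1).
    By e^x >= 1 + x its mean is below 1 as soon as d(p+1) > 1. *)
Lemma chernoff_mean_large d : 0 < d -> chernoff (fun y => y - 1 - d).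
Proof.
intros Hd. destruct (exists_large_inv (d / (1 + d))) as [p Hp].
{ apply Rdiv_lt_0_compat; lra. }
specialize (Hp p (le_n p)). assert (P := pos_INR p).
assert (Q : 0 < INR p + 1) by lra.
apply chernoff_intro with (m := INR p + 2) (t := / (INR p + 2)) (lc := - (1 + d) / (INR p + 2))
  (s := 0) (p := p).
- lra.
- apply Rinv_0_lt_compat. lra.
- lra.
- intros y Hy. right. field. lra.
- rewrite beta_0.
  assert (H : (INR p + 2) / (INR p + 1) < exp ((1 + d) / (INR p + 2))).
  { eapply Rlt_le_trans; [|apply exp_ineq1_le].
    assert (E : 1 < d * (INR p + 1)).
    { apply Rmult_lt_reg_r with (/ (INR p + 1)); [apply Rinv_0_lt_compat, Q|].
      rewrite Rmult_assoc, Rinv_r by lra.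
      apply Rlt_trans with (d / (1 + d)); [lra|].
      apply Rmult_lt_reg_r with (1 + d); [lra|]. unfold Rdiv. rewrite Rmult_assoc, Rinv_l by lra. nra. }
    apply Rmult_lt_reg_r with ((INR p + 1) * (INR p + 2)); [nra|].
    replace ((INR p + 2) / (INR p + 1) * ((INR p + 1) * (INR p + 2)))
      with ((INR p + 2) * (INR p + 2)) by (field; lra).
    replace ((1 + (1 + d) / (INR p + 2)) * ((INR p + 1) * (INR p + 2)))
      with ((INR p + 1) * (INR p + 2 + 1 + d)) by (field; lra).
    nra. }
  replace (- (1 + d) / (INR p + 2)) with (- ((1 + d) / (INR p + 2))) by (field; lra).
  rewrite exp_Ropp, Rmult_assoc.
  apply Rmult_lt_reg_l with (exp ((1 + d) / (INR p + 2))); [apply exp_pos|].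
  rewrite <- Rmult_assoc, Rinv_r, Rmult_1_l, Rmult_1_r by (apply Rgt_not_eq, exp_pos).
  exact H.
Qed.

(** The tilt is e^(t(1-d-y)) with t = 1/(p+1), where E e^(-ty) = (p+1)/(p+2). The condition becomes
    d(p+2) > 1, hence the use of [Hp] at [S p]. *)
Lemma chernoff_mean_small d : 0 < d < 1 -> chernoff (fun y => 1 - d - y).
Proof.
intros Hd. destruct (exists_large_inv d) as [p Hp]; [lra|].
specialize (Hp (S p) (Nat.le_succ_diag_r p)). rewrite S_INR in Hp. assert (P := pos_INR p).
apply chernoff_intro with (m := INR p + 1) (t := / (INR p + 1)) (lc := (1 - d) / (INR p + 1))
  (s := 0) (p := S p).
- lra.
- apply Rinv_0_lt_compat. lra.
- lra.
- intros y Hy. right. rewrite S_INR. field. lra.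
- rewrite beta_0, S_INR.
  assert (H : (INR p + 1) / (INR p + 1 + 1) < exp (- ((1 - d) / (INR p + 1)))).
  { eapply Rlt_le_trans; [|apply exp_ineq1_le].
    assert (E : 1 < d * (INR p + 1 + 1)).
    { apply Rmult_lt_reg_r with (/ (INR p + 1 + 1)); [apply Rinv_0_lt_compat; lra|].
      rewrite Rmult_assoc, Rinv_r by lra. lra. }
    apply Rmult_lt_reg_r with ((INR p + 1) * (INR p + 1 + 1)); [nra|].
    replace ((INR p + 1) / (INR p + 1 + 1) * ((INR p + 1) * (INR p + 1 + 1)))
      with ((INR p + 1) * (INR p + 1)) by (field; lra).
    replace ((1 + - ((1 - d) / (INR p + 1))) * ((INR p + 1) * (INR p + 1 + 1)))
      with ((INR p + d) * (INR p + 1 + 1)) by (field; lra).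
    nra. }
  rewrite exp_Ropp in H. rewrite Rmult_assoc.
  apply Rmult_lt_reg_l with (/ exp ((1 - d) / (INR p + 1))); [apply Rinv_0_lt_compat, exp_pos|].
  rewrite <- Rmult_assoc, Rinv_l, Rmult_1_l, Rmult_1_r by (apply Rgt_not_eq, exp_pos).
  exact H.
Qed.

(** With u = y/m, these are the logarithms of 1 - e^(-u) <= u <= e^u - 1 = e^u (1 - e^(-u)). *)
Lemma one_minus_exp_bounds y m : 0 < y -> 0 < m ->
  ln (1 - exp (- (y / m))) + ln m <= ln y <= ln (1 - exp (- (y / m))) + ln m + y / m.
Proof.
intros Hy Hm. assert (Hk : 0 < y / m) by (apply Rdiv_lt_0_compat; assumption).
assert (Hv : exp (- (y / m)) < 1) by (rewrite <- exp_0; apply exp_increasing; lra).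
assert (E : ln y = ln (y / m) + ln m).
{ rewrite <- ln_mult by assumption. f_equal. field. lra. }
rewrite E. split.
- apply Rplus_le_compat_r, ln_le; [lra|].
  assert (H := exp_ineq1_le (- (y / m))). lra.
- enough (ln (y / m) <= ln (1 - exp (- (y / m))) + y / m) by lra.
  rewrite <- (ln_exp (y / m)) at 3. rewrite <- ln_mult by (try apply exp_pos; lra).
  apply ln_le; [assumption|].
  rewrite Rmult_minus_distr_r, <- exp_plus, Rplus_opp_l, exp_0.
  assert (H := exp_ineq1_le (y / m)). lra.
Qed.

Lemma harmonic_minus_ln gamma e : Un_cv euler_seq gamma -> 0 < e ->
  exists M, forall p, (M <= p)%nat -> Rabs (harmonic p - ln (INR p + 1) - gamma) < e.
Proof.
intros Hg He. destruct (Hg e He) as [M HM]. exists M. intros p Hp.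
specialize (HM (S p)). unfold euler_seq, Rdist in HM. rewrite S_INR in HM.
apply HM. lia.
Qed.

(** The function h is a multiple of (1 - e^(-y/m))^(-t); m = p+1 removes the exponential factor. By
    [beta_le] the logarithm of the mean is at most t(H_(p+1) - ln(p+1) - gamma - d) + 4t^2. *)
Lemma chernoff_log_small gamma d : Un_cv euler_seq gamma -> 0 < d <= 1 ->
  chernoff (fun y => - (ln y + gamma + d)).
Proof.
intros Hg Hd. destruct (harmonic_minus_ln gamma (d / 4) Hg) as [p Hp]; [lra|].
specialize (Hp p (le_n p)). apply Rabs_def2 in Hp. assert (P := pos_INR p).
(* Then 4t^2 = td/4; together with the harmonic error td/4 it is beaten by -td. *)
set (t := d / 16).
apply chernoff_intro with (m := INR p + 1) (t := t) (lc := - t * (gamma + d) - t * ln (INR p + 1))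
  (s := - t) (p := p); unfold t.
- lra.
- lra.
- lra.
- intros y Hy. destruct (one_minus_exp_bounds y (INR p + 1)) as [H _]; [lra..|].
  replace (INR p + 1 - (INR p + 1)) with 0 by ring. nra.
- rewrite Rmult_assoc. eapply Rle_lt_trans.
  { apply Rmult_le_compat_l; [left; apply exp_pos|]. apply beta_le. lra. }
  rewrite <- exp_plus. apply Rlt_le_trans with (exp 0); [apply exp_increasing | rewrite exp_0; lra].
  assert (d * (harmonic p - ln (INR p + 1) - gamma) <= d * (d / 4)) by (apply Rmult_le_compat_l; lra).
  nra.
Qed.

(** The upper bound on ln y carries an extra y/m. Taking m = p+2 puts a factor e^(y/m) into h, which
    covers t y/m because t <= 1; the price is a factor (p+2)/(p+1) <= e^(1/(p+1)) in the mean. *)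
Lemma chernoff_log_large gamma d : Un_cv euler_seq gamma -> 0 < d <= 1 ->
  chernoff (fun y => ln y + gamma - d).
Proof.
intros Hg Hd. destruct (harmonic_minus_ln gamma (d / 4) Hg) as [M1 H1]; [lra|].
(* With t = d/16 this bound is td/8, small enough to pay for e^(1/(p+1)) and for replacing ln(p+2)
   by ln(p+1). *)
destruct (exists_large_inv (d * d / 128)) as [M2 H2]; [nra|].
set (p := Nat.max M1 M2).
specialize (H1 p (Nat.le_max_l _ _)). specialize (H2 p (Nat.le_max_r _ _)).
apply Rabs_def2 in H1. assert (P := pos_INR p).
set (t := d / 16).
assert (L : ln (INR p + 2) <= ln (INR p + 1) + / (INR p + 1)).
{ rewrite <- (ln_exp (/ (INR p + 1))), <- ln_mult by (try apply exp_pos; lra).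
  apply ln_le; [lra|]. apply Rle_trans with ((INR p + 1) * (1 + / (INR p + 1))).
  - right. field. lra.
  - apply Rmult_le_compat_l; [lra | apply exp_ineq1_le]. }
apply chernoff_intro with (m := INR p + 2) (t := t) (lc := t * (gamma - d) + t * ln (INR p + 2))
  (s := t) (p := p); unfold t.
- lra.
- lra.
- lra.
- intros y Hy. destruct (one_minus_exp_bounds y (INR p + 2)) as [_ H]; [lra..|].
  replace (INR p + 1 - (INR p + 2)) with (-1) by ring.
  assert (0 < y / (INR p + 2)) by (apply Rdiv_lt_0_compat; lra). nra.
- rewrite Rmult_assoc. apply Rle_lt_trans with
    (exp (d / 16 * (gamma - d) + d / 16 * ln (INR p + 2)) *
     (exp (/ (INR p + 1)) * exp (- (d / 16) * harmonic p + 4 * (d / 16) ^ 2))).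
  { apply Rmult_le_compat_l; [left; apply exp_pos|].
    apply Rle_trans with ((1 + / (INR p + 1)) * ((INR p + 1) * beta (d / 16) p)).
    - right. field. lra.
    - apply Rmult_le_compat.
      + assert (0 < / (INR p + 1)) by (apply Rinv_0_lt_compat; lra). lra.
      + apply Rmult_le_pos; [lra|]. rewrite <- beta_tail_0. apply beta_tail_nonneg; lra.
      + apply exp_ineq1_le.
      + apply beta_le. lra. }
  rewrite <- !exp_plus. apply Rlt_le_trans with (exp 0); [apply exp_increasing | rewrite exp_0; lra].
  assert (d * - (harmonic p - ln (INR p + 1) - gamma) <= d * (d / 4)) by (apply Rmult_le_compat_l; lra).
  assert (0 < / (INR p + 1)) by (apply Rinv_0_lt_compat; lra).
  set (q := / (INR p + 1)) in *.
  assert (d / 16 * ln (INR p + 2) <= d / 16 * (ln (INR p + 1) + q)) by (apply Rmult_le_compat_l; lra).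
  nra.
Qed.

(** * The gap between weighted means, and its size under concentration *)

Lemma minR_spec n f : (1 <= n)%nat -> (forall i, (i < n)%nat -> 0 < f i) ->
  0 < minR n f /\ forall i, (i < n)%nat -> minR n f <= f i.
Proof.
intros Hn Hf. destruct n as [|n]; [lia|]. clear Hn.
induction n as [|n IH].
- split; [apply Hf; lia|]. intros i Hi. replace i with O by lia. apply Rle_refl.
- change (minR (S (S n)) f) with (Rmin (minR (S n) f) (f (S n))).
  destruct IH as [H1 H2]; [intros i Hi; apply Hf; lia|]. split.
  + apply Rmin_glb_lt; [exact H1 | apply Hf; lia].
  + intros i Hi. destruct (Nat.eq_dec i (S n)) as [->|N]; [apply Rmin_r|].
    eapply Rle_trans; [apply Rmin_l | apply H2; lia].
Qed.

Lemma maxR_spec n f : (1 <= n)%nat -> forall i, (i < n)%nat -> f i <= maxR n f.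
Proof.
intros Hn. destruct n as [|n]; [lia|]. clear Hn.
induction n as [|n IH]; intros i Hi.
- replace i with O by lia. apply Rle_refl.
- change (maxR (S (S n)) f) with (Rmax (maxR (S n) f) (f (S n))).
  destruct (Nat.eq_dec i (S n)) as [->|N]; [apply Rmax_r|].
  eapply Rle_trans; [apply IH; lia | apply Rmax_l].
Qed.

Lemma tangent_le_exp u g : exp g * (1 + u - g) <= exp u.
Proof.
replace u with (g + (u - g)) at 2 by ring. rewrite exp_plus.
apply Rmult_le_compat_l; [left; apply exp_pos|].
assert (H := exp_ineq1_le (u - g)). lra.
Qed.

Lemma sumR_tangent n (b x : nat -> R) g :
  (forall i, (i < n)%nat -> 0 <= b i /\ 0 < x i) ->
  exp g * (sumR n b * (1 - g) + sumR n (fun i => b i * ln (x i))) <= sumR n (fun i => b i * x i).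
Proof.
intros H. apply Rle_trans with (sumR n (fun i => b i * (exp g * (1 + ln (x i) - g)))).
- right. clear H. induction n as [|n IH]; simpl; [ring|]. rewrite <- IH. ring.
- apply sumR_le. intros i Hi. destruct (H i Hi) as [Hb Hx].
  apply Rmult_le_compat_l; [exact Hb|].
  rewrite <- (exp_ln (x i)) at 2 by exact Hx. apply tangent_le_exp.
Qed.

Lemma prodR_rpow n a x : (forall i, (i < n)%nat -> 0 < x i) ->
  prodR n (fun i => rpow (x i) (a i)) = exp (sumR n (fun i => a i * ln (x i))).
Proof.
intros Hx. rewrite <- prodR_exp. apply prodR_ext. intros i Hi.
unfold rpow. destruct (Rlt_dec 0 (x i)) as [_|N]; [reflexivity | elim N; auto].
Qed.

(* Both bounds are the tangent line inequality for [exp], applied at the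
   logarithm of the weighted geometric mean (lower bound) and of the unweighted
   one (upper bound), with the nonnegative weights [a i - c], resp. [c - a i]. *)
Lemma weighted_gap_ge n a x c : (1 <= n)%nat ->
  (forall i, (i < n)%nat -> 0 < x i) -> sumR n a = 1 ->
  0 <= c -> (forall i, (i < n)%nat -> c <= a i) ->
  c * (sumR n x - INR n * exp (sumR n (fun i => ln (x i)) / INR n)) <=
  sumR n (fun i => a i * x i) - prodR n (fun i => rpow (x i) (a i)).
Proof.
intros Hn Hx Ha Hc Hca. rewrite prodR_rpow by exact Hx.
assert (N0 : 0 < INR n) by (apply lt_0_INR; lia).
set (U := sumR n (fun i => ln (x i))). set (s := sumR n (fun i => a i * ln (x i))).
assert (H := sumR_tangent n (fun i => a i + - c) x s).
cbv beta in H.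
rewrite (sumR_ext n (fun i => (a i + - c) * ln (x i)) (fun i => a i * ln (x i) + - c * ln (x i))) in H
  by (intros; ring).
rewrite (sumR_ext n (fun i => (a i + - c) * x i) (fun i => a i * x i + - c * x i)) in H
  by (intros; ring).
rewrite !sumR_plus, !sumR_scal, sumR_const, Ha in H. fold s U in H.
assert (H' : exp s * (1 - INR n * c) * (1 - s) + exp s * (s - c * U) <=
  sumR n (fun i => a i * x i) - c * sumR n x).
{ eapply Rle_trans; [right|eapply Rle_trans; [apply H|]].
  - ring.
  - intros i Hi. assert (Q := Hca i Hi). split; [lra | auto].
  - right. ring. }
(* The same tangent, at s, is evaluated at U/n and weighted by n c. The left sides of [H'] and [G]
   then add up to exactly e^s, the weighted geometric mean. *)
assert (G := tangent_le_exp (U / INR n) s).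
apply (Rmult_le_compat_l (INR n * c)) in G; [|apply Rmult_le_pos; lra].
replace (INR n * c * (exp s * (1 + U / INR n - s)))
  with (INR n * c * exp s * (1 - s) + exp s * c * U) in G by (field; lra).
lra.
Qed.

Lemma weighted_gap_le n a x c : (1 <= n)%nat ->
  (forall i, (i < n)%nat -> 0 < x i) -> sumR n a = 1 ->
  (forall i, (i < n)%nat -> a i <= c) ->
  sumR n (fun i => a i * x i) - prodR n (fun i => rpow (x i) (a i)) <=
  c * (sumR n x - INR n * exp (sumR n (fun i => ln (x i)) / INR n)).
Proof.
intros Hn Hx Ha Hca. rewrite prodR_rpow by exact Hx.
assert (N0 : 0 < INR n) by (apply lt_0_INR; lia).
set (U := sumR n (fun i => ln (x i))). set (s := sumR n (fun i => a i * ln (x i))).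
set (g := U / INR n).
assert (EU : U = INR n * g) by (unfold g; field; lra).
assert (H := sumR_tangent n (fun i => c + - 1 * a i) x g).
cbv beta in H.
rewrite (sumR_ext n (fun i => (c + - 1 * a i) * ln (x i)) (fun i => c * ln (x i) + - 1 * (a i * ln (x i)))) in H
  by (intros; ring).
rewrite (sumR_ext n (fun i => (c + - 1 * a i) * x i) (fun i => c * x i + - 1 * (a i * x i))) in H
  by (intros; ring).
rewrite !sumR_plus, !sumR_scal, sumR_const, Ha in H. fold s U in H.
assert (H' : exp g * (INR n * c - 1) * (1 - g) + exp g * (c * U - s) <=
  c * sumR n x - sumR n (fun i => a i * x i)).
{ eapply Rle_trans; [right|eapply Rle_trans; [apply H|]].
  - ring.
  - intros i Hi. assert (Q := Hca i Hi). split; [lra | auto].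
  - right. ring. }
(* Now the tangent at g is evaluated at s, and the left sides add up to n c e^g. *)
assert (G := tangent_le_exp s g). rewrite EU in H'.
nra.
Qed.

(** The first two sums put lam T/n within d of 1, where T is the l1 norm; the last two put lam e^g
    within a factor e^d of e^(-gamma), where e^g is the geometric mean. Dividing, n e^g/T lies
    strictly between (1-eps)e^(-gamma) and (1+eps)e^(-gamma), and the two gap bounds apply. *)
Lemma gap_of_concentration gamma eps d lam n a x :
  0 < d -> d <= 1 / 4 -> 4 * d <= eps -> 0 < lam -> (1 <= n)%nat ->
  (forall i, (i < n)%nat -> 0 < x i) ->
  (forall i, (i < n)%nat -> 0 < a i) -> sumR n a = 1 ->
  sumR n (fun i => lam * x i - 1 - d) < 0 ->
  sumR n (fun i => 1 - d - lam * x i) < 0 ->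
  sumR n (fun i => - (ln (lam * x i) + gamma + d)) < 0 ->
  sumR n (fun i => ln (lam * x i) + gamma - d) < 0 ->
  (1 - (1 + eps) * exp (- gamma)) * minR n a * sumR n x <
    sumR n (fun i => a i * x i) - prodR n (fun i => rpow (x i) (a i)) /\
  sumR n (fun i => a i * x i) - prodR n (fun i => rpow (x i) (a i)) <
    (1 - (1 - eps) * exp (- gamma)) * maxR n a * sumR n x.
Proof.
intros Hd0 Hd1 Hde Hlam Hn Hx Ha Ha1 H1 H2 H3 H4.
assert (N0 : 0 < INR n) by (apply lt_0_INR; lia).
set (g := sumR n (fun i => ln (x i)) / INR n).
assert (Eg : sumR n (fun i => ln (x i)) = INR n * g) by (unfold g; field; lra).
set (T := sumR n x) in *.
rewrite (sumR_ext n _ (fun i => lam * x i + (- 1 - d))) in H1 by (intros; ring).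
rewrite (sumR_ext n _ (fun i => - lam * x i + (1 - d))) in H2 by (intros; ring).
rewrite (sumR_ext n _ (fun i => - 1 * ln (x i) + - (ln lam + gamma + d))) in H3
  by (intros i Hi; rewrite ln_mult by auto; ring).
rewrite (sumR_ext n _ (fun i => ln (x i) + (ln lam + gamma - d))) in H4
  by (intros i Hi; rewrite ln_mult by auto; ring).
rewrite !sumR_plus, ?sumR_scal, ?sumR_const in *. rewrite Eg in *.
fold T in H1, H2.
assert (G1 : - gamma - d < ln lam + g).
{ apply Rmult_lt_reg_l with (INR n); [exact N0|]. lra. }
assert (G2 : ln lam + g < - gamma + d).
{ apply Rmult_lt_reg_l with (INR n); [exact N0|]. lra. }
apply exp_increasing in G1, G2. unfold Rminus in G1.
rewrite !exp_plus, exp_ln in G1 by exact Hlam. rewrite !exp_plus, exp_ln in G2 by exact Hlam.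
set (E := exp (- gamma)) in *. assert (E0 : 0 < E) by apply exp_pos.
assert (D1 : 1 - d <= exp (- d)) by (assert (Q := exp_ineq1_le (- d)); lra).
assert (D2 : exp d * (1 - d) <= 1).
{ replace 1 with (exp d * exp (- d)) at 2 by (rewrite <- exp_plus, Rplus_opp_r; apply exp_0).
  apply Rmult_le_compat_l; [left; apply exp_pos | exact D1]. }
assert (T0 : 0 < T).
{ apply Rmult_lt_reg_l with lam; [exact Hlam|]. nra. }
assert (K1 : INR n * exp g < (1 + eps) * E * T).
{ apply Rmult_lt_reg_l with lam; [exact Hlam|].
  (* Since e^d (1-d) <= 1, this reduces to (1+4d)(1-d)^2 >= 1, which holds for d <= 1/4. *)
  assert (C : exp d <= (1 + eps) * (1 - d)).
  { apply Rmult_le_reg_r with (1 - d); [lra|]. eapply Rle_trans; [exact D2|].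
    assert (0 <= (eps - 4 * d) * (1 - d) * (1 - d)) by (apply Rmult_le_pos; [apply Rmult_le_pos|]; lra).
    nra. }
  apply Rlt_le_trans with (INR n * (E * exp d)).
  - replace (lam * (INR n * exp g)) with (INR n * (lam * exp g)) by ring.
    apply Rmult_lt_compat_l; assumption.
  - apply Rle_trans with (INR n * (E * ((1 + eps) * (1 - d)))).
    + apply Rmult_le_compat_l; [lra|]. apply Rmult_le_compat_l; lra.
    + replace (INR n * (E * ((1 + eps) * (1 - d)))) with ((1 + eps) * E * (INR n * (1 - d))) by ring.
      replace (lam * ((1 + eps) * E * T)) with ((1 + eps) * E * (lam * T)) by ring.
      apply Rmult_le_compat_l; [apply Rmult_le_pos|]; lra. }
assert (K2 : (1 - eps) * E * T < INR n * exp g).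
{ assert (P : 0 < INR n * exp g) by (apply Rmult_lt_0_compat; [exact N0 | apply exp_pos]).
  (* For eps >= 1 the left side is nonpositive. Otherwise (1-eps)(1+d) <= 1-d <= e^(-d). *)
  destruct (Rle_lt_dec (1 - eps) 0) as [L|L].
  - assert (0 < E * T) by (apply Rmult_lt_0_compat; assumption). nra.
  - apply Rmult_lt_reg_l with lam; [exact Hlam|].
    apply Rle_lt_trans with (INR n * (E * exp (- d))).
    + apply Rle_trans with ((1 - eps) * E * (INR n * (1 + d))).
      * replace (lam * ((1 - eps) * E * T)) with ((1 - eps) * E * (lam * T)) by ring.
        apply Rmult_le_compat_l; [apply Rmult_le_pos|]; lra.
      * replace ((1 - eps) * E * (INR n * (1 + d))) with (INR n * (E * ((1 - eps) * (1 + d)))) by ring.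
        apply Rmult_le_compat_l; [lra|]. apply Rmult_le_compat_l; [lra|]. nra.
    + replace (lam * (INR n * exp g)) with (INR n * (lam * exp g)) by ring.
      apply Rmult_lt_compat_l; assumption. }
destruct (minR_spec n a Hn Ha) as [Hm Hm'].
assert (HM := maxR_spec n a Hn).
assert (HM0 : 0 < maxR n a).
{ apply Rlt_le_trans with (a O); [apply Ha | apply HM]; lia. }
split.
- eapply Rlt_le_trans; [|apply weighted_gap_ge with (c := minR n a); auto; lra].
  fold T g.
  replace ((1 - (1 + eps) * E) * minR n a * T) with (minR n a * (T - (1 + eps) * E * T)) by ring.
  apply Rmult_lt_compat_l; lra.
- eapply Rle_lt_trans; [apply weighted_gap_le with (c := maxR n a); auto|].
  fold T g.
  replace ((1 - (1 - eps) * E) * maxR n a * T) with (maxR n a * (T - (1 - eps) * E * T)) by ring.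
  apply Rmult_lt_compat_l; lra.
Qed.

(** * Geometric decay against n^(-k), and assembly of the cover *)

(** In logarithms, with q = -ln r, the claim is ln 4 + k ln n <= nq. The inequality ln(cn) <= cn - 1
    at c = q/(2k) bounds k ln n by nq/2 plus a constant, and the other nq/2 absorbs the constants
    for n >= N. *)
Lemma geometric_le_inv_Rpower r k : 0 < r < 1 -> 0 < k ->
  exists N, forall n, (1 <= n)%nat -> (N <= n)%nat -> 4 * r ^ n <= / Rpower (INR n) k.
Proof.
intros Hr Hk. set (q := - ln r).
assert (Hq : 0 < q) by (unfold q; assert (Q := ln_increasing r 1 (proj1 Hr) (proj2 Hr)); rewrite ln_1 in Q; lra).
set (c := q / (2 * k)).
assert (Hc : 0 < c) by (apply Rdiv_lt_0_compat; lra).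
destruct (INR_unbounded ((ln 4 - k - k * ln c) * (2 / q))) as [N HN].
exists N. intros n Hn HNn.
assert (N0 : 0 < INR n) by (apply lt_0_INR; lia).
assert (LN : INR N <= INR n) by (apply le_INR; exact HNn).
assert (B : ln 4 - k - k * ln c <= INR n * q / 2).
{ replace (ln 4 - k - k * ln c) with ((ln 4 - k - k * ln c) * (2 / q) * (q / 2)) by (field; lra).
  replace (INR n * q / 2) with (INR n * (q / 2)) by field.
  apply Rmult_le_compat_r; lra. }
assert (L : ln c + ln (INR n) <= c * INR n - 1).
{ rewrite <- ln_mult by assumption.
  assert (Q := exp_ineq1_le (ln (c * INR n))). rewrite exp_ln in Q by (apply Rmult_lt_0_compat; assumption). lra. }
apply (Rmult_le_compat_l k) in L; [|lra].
replace (k * (c * INR n - 1)) with (INR n * q / 2 - k) in L by (unfold c; field; lra).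
unfold Rpower. rewrite <- exp_Ropp.
replace (4 * r ^ n) with (exp (ln 4 - INR n * q)).
- apply exp_le. lra.
- unfold Rminus. rewrite exp_plus, exp_ln by lra. f_equal.
  rewrite <- (exp_ln (r ^ n)) by (apply pow_lt; lra). f_equal.
  rewrite ln_pow by lra. unfold q. ring.
Qed.

Lemma sumR_succ_l n f : sumR (S n) f = f O + sumR n (fun i => f (S i)).
Proof. induction n as [|n IH]; [simpl; ring|]. cbn [sumR] in *. rewrite IH. ring. Qed.

Lemma sumR_sum_f_R0 n f : sumR (S n) f = sum_f_R0 f n.
Proof. induction n as [|n IH]; [simpl; ring|]. cbn [sumR sum_f_R0] in *. rewrite IH. reflexivity. Qed.

Lemma prodR_nonneg n f : (forall i, (i < n)%nat -> 0 <= f i) -> 0 <= prodR n f.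
Proof.
induction n as [|n IH]; intros H; simpl; [lra|].
apply Rmult_le_pos; [apply IH; intros i Hi|]; apply H; lia.
Qed.

Lemma sumR_le_limit (u : nat -> R) L : (forall j, 0 <= u j) ->
  Un_cv (fun N => sum_f_R0 u N) L -> forall N, sumR N u <= L.
Proof.
intros Hu HL N. apply Rle_trans with (sumR (S N) u).
- simpl. specialize (Hu N). lra.
- rewrite sumR_sum_f_R0. apply (growing_ineq (fun N => sum_f_R0 u N)); [|exact HL].
  intros m. simpl. specialize (Hu (S m)). lra.
Qed.

Definition interval_indicator (a b x : R) : R :=
  if Rle_dec a x then if Rle_dec x b then 1 else 0 else 0.

Theorem theorem4p3 :
  forall (gamma : R), Un_cv euler_seq gamma ->
  forall (k eps : R), 0 < k -> 0 < eps ->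
  exists N : nat,
  forall (lam : R) (alpha : nat -> nat -> R),
    0 < lam ->
    (forall n, (2 <= n)%nat ->
       (forall i, (i < n)%nat -> 0 < alpha n i) /\ sumR n (alpha n) = 1) ->
    forall n : nat, (2 <= n)%nat -> (N <= n)%nat ->
    prob_ge lam n
      (fun x =>
         (forall i, (i < n)%nat -> 0 <= x i) /\
         let l1 := sumR n x in
         let D := sumR n (fun i => alpha n i * x i)
                  - prodR n (fun i => rpow (x i) (alpha n i)) in
         (1 - (1 + eps) * exp (- gamma)) * minR n (alpha n) * l1 < D /\
         D < (1 - (1 - eps) * exp (- gamma)) * maxR n (alpha n) * l1)
      (1 - / Rpower (INR n) k).
Proof.
intros gamma Hgamma k eps Hk Heps.
(* This meets the two smallness conditions of [gap_of_concentration]. It is fixed before [lam] and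
   [alpha], and so are the four rates and [N]. *)
set (d := Rmin (1 / 4) (eps / 4)).
assert (Hd0 : 0 < d) by (apply Rmin_glb_lt; lra).
assert (Hd1 : d <= 1 / 4) by apply Rmin_l.
assert (Hd2 : d <= eps / 4) by apply Rmin_r.
destruct (chernoff_mean_large d) as (h1 & r1 & R1 & M1 & P1); [lra|].
destruct (chernoff_mean_small d) as (h2 & r2 & R2 & M2 & P2); [lra|].
destruct (chernoff_log_small gamma d Hgamma) as (h3 & r3 & R3 & M3 & P3); [lra|].
destruct (chernoff_log_large gamma d Hgamma) as (h4 & r4 & R4 & M4 & P4); [lra|].
set (r := Rmax (Rmax r1 r2) (Rmax r3 r4)).
assert (Hr1 : r1 <= r) by (eapply Rle_trans; [apply Rmax_l | apply Rmax_l]).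
assert (Hr2 : r2 <= r) by (eapply Rle_trans; [apply Rmax_r | apply Rmax_l]).
assert (Hr3 : r3 <= r) by (eapply Rle_trans; [apply Rmax_l | apply Rmax_r]).
assert (Hr4 : r4 <= r) by (eapply Rle_trans; [apply Rmax_r | apply Rmax_r]).
assert (Hr : 0 < r < 1) by (split; [lra | repeat apply Rmax_lub_lt; lra]).
destruct (geometric_le_inv_Rpower r k Hr Hk) as [N HN].
exists N. intros lam alpha Hlam Halpha n Hn HNn C Hcov L HL.
destruct (Halpha n Hn) as [Ha Ha1].
specialize (HN n (Nat.le_trans 1 2 n (Nat.le_succ_diag_r 1) Hn) HNn).
enough (1 <= r1 ^ n + (r2 ^ n + (r3 ^ n + (r4 ^ n + L)))).
{ assert (forall q, 0 < q -> q <= r -> q ^ n <= r ^ n) by (intros; apply pow_incr; lra).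
  assert (r1 ^ n <= r ^ n) by (apply H0; lra).
  assert (r2 ^ n <= r ^ n) by (apply H0; lra).
  assert (r3 ^ n <= r ^ n) by (apply H0; lra).
  assert (r4 ^ n <= r ^ n) by (apply H0; lra).
  lra. }
(* Indices 0 to 3 hold the Chernoff products; index l+4 holds the indicator of the box [C l]. *)
apply exponential_product_coverR with (lam := lam) (n := n)
  (h := fun j i x => match j with
        | 0%nat => h1 (lam * x) | 1%nat => h2 (lam * x)
        | 2%nat => h3 (lam * x) | 3%nat => h4 (lam * x)
        | S (S (S (S l))) => interval_indicator (fst (C l) i) (snd (C l) i) x
        end)
  (r := fun j i => match j with
        | 0%nat => r1 | 1%nat => r2 | 2%nat => r3 | 3%nat => r4
        | S (S (S (S l))) => Rmax 0 (expCDF lam (snd (C l) i) - expCDF lam (fst (C l) i))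
        end).
- exact Hlam.
- intros [|[|[|[|l]]]] i; auto.
  apply exp_mean_leR_interval; [exact Hlam | |]; unfold interval_indicator; intros x Hx.
  + destruct (Rle_dec _ x) as [A|A]; [destruct (Rle_dec x _) as [B|B]; [reflexivity|]|]; tauto.
  + destruct (Rle_dec _ x) as [A|A]; [destruct (Rle_dec x _) as [B|B]; [tauto|]|]; reflexivity.
- intros x Hx.
  assert (Hy : forall i, (i < n)%nat -> 0 < lam * x i)
    by (intros i Hi; apply Rmult_lt_0_compat; auto).
  destruct (Rle_lt_dec 0 (sumR n (fun i => lam * x i - 1 - d))) as [S1|S1].
  { exists 0%nat. apply (P1 n (fun i => lam * x i)); assumption. }
  destruct (Rle_lt_dec 0 (sumR n (fun i => 1 - d - lam * x i))) as [S2|S2].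
  { exists 1%nat. apply (P2 n (fun i => lam * x i)); assumption. }
  destruct (Rle_lt_dec 0 (sumR n (fun i => - (ln (lam * x i) + gamma + d)))) as [S3|S3].
  { exists 2%nat. apply (P3 n (fun i => lam * x i)); assumption. }
  destruct (Rle_lt_dec 0 (sumR n (fun i => ln (lam * x i) + gamma - d))) as [S4|S4].
  { exists 3%nat. apply (P4 n (fun i => lam * x i)); assumption. }
  destruct (Hcov x) as [j Hj].
  { split; [intros i Hi; left; auto|].
    apply gap_of_concentration with (d := d) (lam := lam); auto; lia || lra. }
  exists (S (S (S (S j)))). right. symmetry.
  rewrite (prodR_ext n _ (fun _ => 1)), prodR_const, pow1; [reflexivity|].
  intros i Hi. destruct (Hj i Hi) as [A B]. unfold interval_indicator.
  destruct (Rle_dec _ (x i)); [destruct (Rle_dec (x i) _)|]; tauto.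
- intros N'.
  set (u := fun j => prodR n _).
  assert (U0 : forall j, 0 <= u j).
  { intros j. apply prodR_nonneg. intros i _. destruct j as [|[|[|[|j]]]]; try lra. apply Rmax_l. }
  (* Lengthening the partial sum by four nonnegative terms lets the Chernoff terms be split off at
     the front for every [N'], leaving a partial sum of box masses. *)
  apply Rle_trans with (sumR (4 + N') u).
  { simpl. assert (Q := U0 N'). assert (Q1 := U0 (S N')). assert (Q2 := U0 (S (S N'))).
    assert (Q3 := U0 (S (S (S N')))). lra. }
  change (4 + N')%nat with (S (S (S (S N')))). rewrite !sumR_succ_l.
  unfold u at 1 2 3 4. rewrite !prodR_const.
  do 4 apply Rplus_le_compat_l.
  apply (sumR_le_limit (fun j => box_prob lam n (C j))); [|exact HL].
  intros j. apply (U0 (S (S (S (S j))))).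
Qed.
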